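(* Let $S$ be a nonempty finite set of positive integers and $k\geq 0$ an integer. Then for all $n\geq 2\max S+k$, for every $\ell$ with $0\leq \ell\leq k$ and every partition $\mu$ of $\ell$, the inner products $\langle \alpha_S(n), h_{n-\ell}s_\mu\rangle$ and $\langle \beta_S(n), h_{n-\ell}s_\mu\rangle$ are independent of $n$. Equivalently, for $n\geq 2\max S+k$ and $0\leq\ell\leq k$, the skewed symmetric functions $D_{(n-\ell)}\alpha_S(n)$ and $D_{(n-\ell)}\beta_S(n)$ (of degree $\ell$) are independent of $n$. Consequently, for $n\geq 2\max S+k$, the multiplicity in $\alpha_S(n)$ and in $\beta_S(n)$ of any irreducible indexed by a partition $\lambda$ of $n$ whose Schur function $s_\lambda$ is a fixed integer linear combination of the functions $h_{n-\ell}s_\mu$ ($0\le \ell\le k$, $\mu\vdash\ell$), with coefficients independent of $n$, is independent of $n$.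
   Context: $\Pi_n$ is the lattice of set partitions of $[n]$ ordered by refinement; a partition with $k$ blocks has rank $n-k$; nontrivial ranks are $1,\dots,n-2$. For $S\subseteq[1,n-2]$, $\Pi_n(S)$ is the rank-selected subposet of partitions with rank in $S$; it is Cohen–Macaulay, so its order complex has reduced homology only in top degree. $\alpha_S(n)$ denotes both the permutation representation of $S_n$ on the maximal chains of $\Pi_n(S)$ and its Frobenius characteristic (a symmetric function of degree $n$); $\beta_S(n)$ denotes both the $S_n$-representation on the unique nonvanishing reduced homology (over $\mathbb{C}$) of $\Pi_n(S)$ and its Frobenius characteristic. $h_m$ is the complete homogeneous symmetric function (characteristic of the trivial representation of $S_m$), $s_\mu$ the Schur function, and $\langle\cdot,\cdot\rangle$ the Hall inner product, for which the Schur functions are orthonormal. For a partition $\mu$ of $m$ and a symmetric function $f$ of degree $n$, the skewing $D_\mu f$ is the symmetric function of degree $n-m$ defined by $\langle D_\mu f, s_\nu\rangle=\langle f, s_\mu s_\nu\rangle$ for all partitions $\nu$ of $n-m$. *)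

(* Defs.v *)
From HB Require Import structures.
From mathcomp Require Import all_boot all_order all_algebra all_fingroup all_character algC.
Set Implicit Arguments. Unset Strict Implicit. Unset Printing Implicit Defensive.
Import GRing.Theory Num.Theory.
Local Open Scope ring_scope.

Definition setpart (n : nat) := {set {set 'I_n}}.

Definition is_setpart (n : nat) (P : setpart n) : bool := partition P [set: 'I_n].

Definition prank (n : nat) (P : setpart n) : nat := (n - #|P|)%N.

Definition refines (n : nat) (P Q : setpart n) : bool :=
  [forall B in P, exists C in Q, B \subset C].

Definition refines_strict (n : nat) (P Q : setpart n) : bool :=
  (P != Q) && refines P Q.

(* S is given as a list of naturals; only its underlying set matters. *)
Definition PiS (n : nat) (S : seq nat) : {set setpart n} :=
  [set P | is_setpart P && (prank P \in S)].

(* chains of Pi_n(S) (faces of the order complex, including the empty chain) *)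
Definition is_chain (n : nat) (S : seq nat) (C : {set setpart n}) : bool :=
  (C \subset PiS n S) &&
  [forall P in C, forall Q in C, refines P Q || refines Q P].

Definition chains (n : nat) (S : seq nat) : {set {set setpart n}} :=
  [set C | is_chain S C].

Definition maxchains (n : nat) (S : seq nat) : {set {set setpart n}} :=
  [set C in chains n S | [forall D in chains n S, (C \subset D) ==> (D == C)]].

Definition act_part (n : nat) (g : 'S_n) (P : setpart n) : setpart n :=
  [set [set g x | x in B] | B : {set 'I_n} in P].

Definition act_chain (n : nat) (g : 'S_n) (C : {set setpart n}) : {set setpart n} :=
  [set act_part g P | P in C].

Definition alpha_char (S : seq nat) (n : nat) (g : 'S_n) : algC :=
  #|[set C in maxchains n S | act_chain g C == C]|%:R.

Definition topsize (n : nat) (S : seq nat) : nat := \max_(C in chains n S) #|C|.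

Definition topchains (n : nat) (S : seq nat) : {set {set setpart n}} :=
  [set C in chains n S | #|C| == topsize n S].

(* chains of one less cardinality (the empty chain included: reduced complex) *)
Definition subchains (n : nat) (S : seq nat) : {set {set setpart n}} :=
  [set C in chains n S | #|C| == (topsize n S).-1].

(* top boundary map (row-vector convention): a chain x_0 < ... < x_r is sent to
   sum_j (-1)^j (chain with x_j removed); the position j of x in C is the number
   of elements of C strictly below x. *)
Definition boundary (n : nat) (S : seq nat) :
    'M[algC]_(#|topchains n S|, #|subchains n S|) :=
  \matrix_(i, j)
    let Ci := @enum_val _ (topchains n S) i in
    let Cj := @enum_val _ (subchains n S) j in
    \sum_(P in Ci | Ci :\ P == Cj)
       (-1) ^+ #|[set Q in Ci | refines_strict Q P]|.

Definition chain_permmx (n : nat) (S : seq nat) (g : 'S_n) :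
    'M[algC]_(#|topchains n S|) :=
  \matrix_(i, j)
    (@enum_val _ (topchains n S) j == act_chain g (@enum_val _ (topchains n S) i))%:R.

(* Top reduced homology = kernel of the top boundary map (no higher chains).
   Its character: trace of g on the (g-stable) row space ker(boundary), computed
   in the basis given by the rows of B = row_base (kermx boundary). *)
Definition beta_char (S : seq nat) (n : nat) (g : 'S_n) : algC :=
  let B := row_base (kermx (boundary n S)) in
  \tr (B *m chain_permmx S g *m pinvmx B).

Definition psum_fun (m l : nat) (a : 'S_m) (b : 'S_l) (x : 'I_(m + l)) : 'I_(m + l) :=
  unsplit (match split x with inl j => inl (a j) | inr j => inr (b j) end).

Lemma psum_inj (m l : nat) (a : 'S_m) (b : 'S_l) : injective (psum_fun a b).
Proof.
move=> x y /(can_inj (@unsplitK m l)) H.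
rewrite -(splitK x) -(splitK y); congr unsplit.
move: H; case: (split x) => u; case: (split y) => v //= [] /perm_inj -> //.
Qed.

Definition psum (m l : nat) (a : 'S_m) (b : 'S_l) : 'S_(m + l) := perm (@psum_inj m l a b).

(* <ch chi_{m+l}, h_m s_mu> for the class function chi_{m+l} of S_(m+l), where
   s_mu = ch('chi_i) for an irreducible character 'chi_i of S_l; by Frobenius
   reciprocity this equals the inner product over the Young subgroup S_m x S_l
   of Res chi with (trivial x 'chi_i). *)
Definition young_dot (chi : forall N : nat, 'S_N -> algC) (m l : nat)
    (i : Iirr [set: 'S_l]%G) : algC :=
  ((m`! * l`!)%:R)^-1 *
  \sum_(a : 'S_m) \sum_(b : 'S_l) chi (m + l)%N (psum a b) * ('chi[[set: 'S_l]%G]_i b)^*.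

(* Main.v *)
Require Import Defs.
From HB Require Import structures.
From mathcomp Require Import all_boot all_order all_algebra all_fingroup all_character algC.
From mathcomp Require Import zify.
Set Implicit Arguments. Unset Strict Implicit. Unset Printing Implicit Defensive.
Import GRing.Theory Num.Theory.
Local Open Scope ring_scope.

(** Averaging a character of 'S_(m + l) over 'S_m reduces the claim to traces
    on 'S_m-coinvariants.  A chain of ranks in S moves at most 2 max S points
    out of singleton blocks, so for m >= 2 max S adding a singleton block
    induces an 'S_l-equivariant bijection from 'S_m-orbits of chains on m + l
    points to 'S_(m+1)-orbits of chains on m + 1 + l points.  This bijection
    commutes with the boundary maps, so it identifies the coinvariants of the
    chain groups and of the kernel of the top boundary map. *)

(** * Set partitions, refinement and the action of the symmetric group *)

Lemma setpartP n (P : setpart n) :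
  reflect [/\ forall x, exists2 B, B \in P & x \in B,
              forall B C x, B \in P -> C \in P -> x \in B -> x \in C -> B = C
            & set0 \notin P]
          (is_setpart P).
Proof.
apply: (iffP and3P) => [[/eqP cP tP P0]|[cP tP P0]]; split=> //.
- by move=> x; have := in_setT x; rewrite -cP => /bigcupP[B]; exists B.
- move=> B C x BP CP xB xC.
  by rewrite -(def_pblock tP BP xB) (def_pblock tP CP xC).
- apply/eqP/setP=> x; rewrite inE; apply/bigcupP.
  by have [B BP xB] := cP x; exists B.
- apply/trivIsetP => B C BP CP nBC; rewrite -setI_eq0; apply/set0Pn => -[x].
  by rewrite inE => /andP[xB xC]; move/eqP: nBC; apply; apply: tP xB xC.
Qed.

Lemma refinesP n (P Q : setpart n) :
  reflect (forall B, B \in P -> exists2 C, C \in Q & B \subset C) (refines P Q).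
Proof. by apply: (iffP forall_inP) => H B /H/exists_inP. Qed.

Lemma act_partM n (g h : 'S_n) (P : setpart n) :
  act_part (g * h)%g P = act_part h (act_part g P).
Proof.
rewrite /act_part -imset_comp; apply: eq_imset => B /=.
by rewrite -imset_comp; apply: eq_imset => x /=; rewrite permM.
Qed.

Lemma act_part1 n (P : setpart n) : act_part 1%g P = P.
Proof.
rewrite /act_part -[RHS]imset_id; apply: eq_imset => B.
by rewrite -[RHS]imset_id; apply: eq_imset => x; rewrite perm1.
Qed.

Lemma act_partK n (g : 'S_n) : cancel (act_part g) (act_part g^-1%g).
Proof. by move=> P; rewrite -act_partM mulgV act_part1. Qed.

Lemma act_part_inj n (g : 'S_n) : injective (act_part g).
Proof. exact: can_inj (act_partK g). Qed.

Lemma card_act_part n (g : 'S_n) (P : setpart n) : #|act_part g P| = #|P|.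
Proof. exact/card_imset/imset_inj/perm_inj. Qed.

Lemma act_setpart_imp n (g : 'S_n) (P : setpart n) :
  is_setpart P -> is_setpart (act_part g P).
Proof.
move=> /setpartP[cP tP P0]; apply/setpartP; split.
- move=> x; have [B BP xB] := cP (g^-1%g x).
  by exists (g @: B); [exact: imset_f | rewrite -[x](permKV g) imset_f].
- move=> _ _ x /imsetP[B BP ->] /imsetP[C CP ->] /imsetP[y yB ->] /imsetP[z zC].
  by move=> /perm_inj yz; rewrite (tP B C y) // yz.
- apply/imsetP => -[B BP /esym/eqP]; rewrite imset_eq0 => /eqP B0.
  by rewrite B0 in BP; rewrite BP in P0.
Qed.

Lemma act_setpart n (g : 'S_n) (P : setpart n) :
  is_setpart (act_part g P) = is_setpart P.
Proof.
apply/idP/idP => [|/act_setpart_imp//].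
by move=> /(act_setpart_imp g^-1%g); rewrite act_partK.
Qed.

Lemma refines_act_imp n (g : 'S_n) (P Q : setpart n) :
  refines P Q -> refines (act_part g P) (act_part g Q).
Proof.
move=> /refinesP H; apply/refinesP => _ /imsetP[B BP ->].
by have [C CQ sBC] := H B BP; exists (g @: C); [exact: imset_f | exact: imsetS].
Qed.

Lemma refines_act n (g : 'S_n) (P Q : setpart n) :
  refines (act_part g P) (act_part g Q) = refines P Q.
Proof.
apply/idP/idP => [|/refines_act_imp//].
by move=> /(refines_act_imp g^-1%g); rewrite !act_partK.
Qed.

Lemma refines_strict_act n (g : 'S_n) (P Q : setpart n) :
  refines_strict (act_part g P) (act_part g Q) = refines_strict P Q.
Proof. by rewrite /refines_strict refines_act (inj_eq (@act_part_inj _ g)). Qed.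

Lemma act_chainM n (g h : 'S_n) (C : {set setpart n}) :
  act_chain (g * h)%g C = act_chain h (act_chain g C).
Proof.
by rewrite /act_chain -imset_comp; apply: eq_imset => P; exact: act_partM.
Qed.

Lemma act_chain1 n (C : {set setpart n}) : act_chain 1%g C = C.
Proof.
by rewrite -[RHS]imset_id; apply: eq_imset => P; exact: act_part1.
Qed.

Lemma act_chainK n (g : 'S_n) : cancel (act_chain g) (act_chain g^-1%g).
Proof. by move=> C; rewrite -act_chainM mulgV act_chain1. Qed.

Lemma card_act_chain n (g : 'S_n) (C : {set setpart n}) :
  #|act_chain g C| = #|C|.
Proof. exact/card_imset/act_part_inj. Qed.

(** * Chains of the rank-selected poset *)

Lemma chainsP n S (C : {set setpart n}) :
  reflect ((forall P, P \in C -> is_setpart P /\ prank P \in S) /\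
           (forall P Q, P \in C -> Q \in C -> refines P Q || refines Q P))
          (C \in chains n S).
Proof.
rewrite inE; apply: (iffP andP) => [[/subsetP sC /forall_inP tC]|[sC tC]]; split.
- by move=> P /sC; rewrite inE => /andP.
- by move=> P Q PC QC; exact: (forall_inP (tC P PC)).
- by apply/subsetP => P /sC[Pp PS]; rewrite inE Pp.
- by apply/forall_inP => P PC; apply/forall_inP => Q; exact: tC.
Qed.

Lemma chains_sub n S (C D : {set setpart n}) :
  C \subset D -> D \in chains n S -> C \in chains n S.
Proof.
move=> /subsetP sCD /chainsP[pD tD]; apply/chainsP; split=> [P /sCD/pD //|].
by move=> P Q /sCD PD /sCD; exact: tD.
Qed.

Lemma act_chains n S (g : 'S_n) (C : {set setpart n}) :
  (act_chain g C \in chains n S) = (C \in chains n S).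
Proof.
suff imp h D : D \in chains n S -> act_chain h D \in chains n S.
  by apply/idP/idP => [/(imp g^-1%g)|]; [rewrite act_chainK | exact: imp].
move=> /chainsP[pC tC]; apply/chainsP; split=> [_ /imsetP[P PC ->]|].
  by rewrite act_setpart /prank card_act_part; exact: pC.
by move=> _ _ /imsetP[P PC ->] /imsetP[Q QC ->]; rewrite !refines_act; exact: tC.
Qed.

(** * Adding and deleting a singleton block *)

(* The added point is [ord0], so it lies in the first summand of [m.+1 + l]. *)
Definition ext_part n (P : setpart n) : setpart n.+1 :=
  [set ord0] |: [set [set lift ord0 x | x in B] | B : {set 'I_n} in P].

(** The block [[set ord0]] is dropped before preimages are taken, since its preimage would be an
    empty block. *)
Definition del_part n (Q : setpart n.+1) : setpart n :=
  [set lift ord0 @^-1: B | B : {set 'I_n.+1} in Q :\ [set ord0]].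

Lemma lift_imset_neq n (B : {set 'I_n}) : lift ord0 @: B != [set ord0].
Proof.
apply/eqP => /setP/(_ ord0); rewrite in_set1 eqxx => /imsetP[x _ /eqP].
by rewrite (negPf (neq_lift _ _)).
Qed.

Lemma ext_partK n : cancel (@ext_part n) (@del_part n).
Proof.
move=> P; rewrite /del_part /ext_part setU1K; last first.
  apply/imsetP => -[B _ /eqP]; by rewrite eq_sym (negPf (lift_imset_neq B)).
rewrite -imset_comp -[RHS]imset_id; apply: eq_imset => B /=.
by apply/setP => x; rewrite inE mem_imset //; exact: lift_inj.
Qed.

Lemma ext_part_inj n : injective (@ext_part n).
Proof. exact: can_inj (@ext_partK n). Qed.

Lemma card_ext_part n (P : setpart n) : #|ext_part P| = #|P|.+1.
Proof.
rewrite cardsU1 card_imset; last exact/imset_inj/lift_inj.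
case: imsetP => // -[B _ /eqP]; by rewrite eq_sym (negPf (lift_imset_neq B)).
Qed.

(** Points and blocks both grow by one, so a fixed [S] selects corresponding partitions on both
    sides. *)
Lemma prank_ext n (P : setpart n) : prank (ext_part P) = prank P.
Proof. by rewrite /prank card_ext_part subSS. Qed.

(** By disjointness no other block contains [ord0], so each of them is the lift of its own
    preimage. *)
Lemma del_partK n (Q : setpart n.+1) :
  is_setpart Q -> [set ord0] \in Q -> ext_part (del_part Q) = Q.
Proof.
move=> /setpartP[_ tQ _] Q0; rewrite /ext_part /del_part -imset_comp.
rewrite -[RHS](setD1K Q0); congr (_ |: _).
rewrite -[RHS]imset_id; apply: eq_in_imset => B; rewrite !inE => /andP[B0 BQ].
apply/setP => x /=; case: (unliftP ord0 x) => [y|] ->.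
  by rewrite mem_imset ?inE //; exact: lift_inj.
transitivity false.
  by apply/imsetP => -[y _ /eqP]; rewrite (negPf (neq_lift _ _)).
apply/esym/negP => xB; case/eqP: B0.
by apply: (tQ _ _ ord0) => //; rewrite inE.
Qed.

Lemma ext_setpart n (P : setpart n) : is_setpart (ext_part P) = is_setpart P.
Proof.
have in0 (B : {set 'I_n}) : ord0 \in lift ord0 @: B = false.
  by apply/imsetP => -[y _ /eqP]; rewrite (negPf (neq_lift _ _)).
have inL (B : {set 'I_n}) x : (lift ord0 x \in lift ord0 @: B) = (x \in B).
  by rewrite mem_imset //; exact: lift_inj.
have extE (B : {set 'I_n}) : B \in P -> lift ord0 @: B \in ext_part P.
  by move=> BP; rewrite in_setU1 imset_f ?orbT.
apply/setpartP/setpartP => -[cP tP P0]; split.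
- move=> x; have [_ /setU1P[->|/imsetP[B BP ->]]] := cP (lift ord0 x).
    by rewrite inE eq_sym (negPf (neq_lift _ _)).
  by rewrite inL => xB; exists B.
- move=> B C x /extE BP /extE CP xB xC.
  apply: (imset_inj (@lift_inj _ ord0)); move: (tP _ _ (lift ord0 x) BP CP).
  by rewrite !inL => ->.
- by apply: contra P0 => /extE; rewrite imset0.
- move=> x; case: (unliftP ord0 x) => [y|] ->.
    by have [B /extE BP yB] := cP y; exists (lift ord0 @: B); rewrite ?inL.
  by exists [set ord0]; rewrite ?inE ?eqxx.
- move=> _ _ x /setU1P[->|/imsetP[B BP ->]] /setU1P[->|/imsetP[C CP ->]] //.
  + by rewrite inE => /eqP ->; rewrite in0.
  + by rewrite !inE => + /eqP xE; rewrite xE in0.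
  + by case/imsetP=> y yB ->; rewrite inL => yC; rewrite (tP B C y).
- apply/setU1P => -[/esym/eqP|/imsetP[B BP /esym/eqP]].
    by apply/negP/set0Pn; exists ord0; rewrite inE.
  by rewrite imset_eq0 => /eqP B0; rewrite B0 in BP; rewrite BP in P0.
Qed.

(** Nonempty blocks matter here: an empty block of [P] would fit inside [[set ord0]] even if [Q] had
    no block at all. *)
Lemma refines_ext n (P Q : setpart n) : is_setpart P ->
  refines (ext_part P) (ext_part Q) = refines P Q.
Proof.
move=> /setpartP[_ _ P0].
apply/refinesP/refinesP => H B.
  move=> BP; have [|C] := H (lift ord0 @: B).
    by rewrite in_setU1 imset_f ?orbT.
  have /set0Pn[x xB]: B != set0 by apply: contraNneq P0 => <-.
  case/setU1P=> [->|/imsetP[C' C'Q ->]] /subsetP sBC.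
    have := sBC _ (imset_f (lift ord0) xB).
    by rewrite inE eq_sym (negPf (neq_lift _ _)).
  exists C' => //; apply/subsetP => y yB; have := sBC _ (imset_f (lift ord0) yB).
  by rewrite mem_imset //; exact: lift_inj.
case/setU1P=> [->|/imsetP[B' /H[C CQ sBC] ->]].
  by exists [set ord0]; rewrite ?inE ?eqxx.
by exists (lift ord0 @: C); [rewrite in_setU1 imset_f ?orbT | exact: imsetS].
Qed.

Lemma ext_act_part n (g : 'S_n) (P : setpart n) :
  ext_part (act_part g P) = act_part (lift_perm ord0 ord0 g) (ext_part P).
Proof.
rewrite /ext_part /act_part imsetU1 imset_set1 lift_perm_id; congr (_ |: _).
rewrite -!imset_comp; apply: eq_imset => B /=.
by rewrite -!imset_comp; apply: eq_imset => x /=; rewrite lift_perm_lift.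
Qed.

Definition ext_chain n (C : {set setpart n}) : {set setpart n.+1} :=
  [set ext_part P | P in C].

Lemma ext_chain_inj n : injective (@ext_chain n).
Proof. exact/imset_inj/ext_part_inj. Qed.

Lemma card_ext_chain n (C : {set setpart n}) : #|ext_chain C| = #|C|.
Proof. exact/card_imset/ext_part_inj. Qed.

Lemma ext_act_chain n (g : 'S_n) (C : {set setpart n}) :
  ext_chain (act_chain g C) = act_chain (lift_perm ord0 ord0 g) (ext_chain C).
Proof.
rewrite /ext_chain /act_chain -!imset_comp; apply: eq_imset => P /=.
exact: ext_act_part.
Qed.

Lemma ext_chains n S (C : {set setpart n}) :
  (ext_chain C \in chains n.+1 S) = (C \in chains n S).
Proof.
apply/chainsP/chainsP => -[pC tC].
  have pC' P : P \in C -> is_setpart P /\ prank P \in S.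
    by move=> PC; rewrite -ext_setpart -prank_ext; apply/pC/imset_f.
  split=> // P Q PC QC; have [[Pp _] [Qp _]] := (pC' P PC, pC' Q QC).
  by rewrite -(refines_ext Q Pp) -(refines_ext P Qp); apply: tC; exact: imset_f.
split=> [_ /imsetP[P PC ->]|_ _ /imsetP[P PC ->] /imsetP[Q QC ->]].
  by rewrite ext_setpart prank_ext; exact: pC.
by rewrite !refines_ext; [exact: tC | case: (pC Q) | case: (pC P)].
Qed.

Lemma del_chainK n S (D : {set setpart n.+1}) : D \in chains n.+1 S ->
  (forall P, P \in D -> [set ord0] \in P) -> ext_chain [set del_part P | P in D] = D.
Proof.
move=> /chainsP[pD _] D0; rewrite /ext_chain -imset_comp -[RHS]imset_id.
by apply: eq_in_imset => P PD /=; rewrite del_partK ?D0 //; case: (pD P).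
Qed.

(** * The Young subgroup and the stabiliser of the added point *)

Lemma psum_lshift m l (a : 'S_m) (b : 'S_l) x :
  psum a b (lshift l x) = lshift l (a x).
Proof. by rewrite permE /psum_fun -[lshift l x]/(unsplit (inl x)) unsplitK. Qed.

Lemma psum_rshift m l (a : 'S_m) (b : 'S_l) x :
  psum a b (rshift m x) = rshift m (b x).
Proof. by rewrite permE /psum_fun -[rshift m x]/(unsplit (inr x)) unsplitK. Qed.

Lemma psumM m l (a a' : 'S_m) (b b' : 'S_l) :
  psum (a * a')%g (b * b')%g = (psum a b * psum a' b')%g.
Proof.
by apply/permP => x; rewrite permM; case: (split_ordP x) => y ->;
  rewrite ?psum_lshift ?psum_rshift permM.
Qed.

Lemma psum1 m l : psum 1 1 = 1%g :> 'S_(m + l).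
Proof.
by apply/permP => x; rewrite perm1; case: (split_ordP x) => y ->;
  rewrite ?psum_lshift ?psum_rshift perm1.
Qed.

(** [m.+1 + l] reduces to [(m + l).+1], and the added point is the first one of the left summand, so
    the factor ['S_l] is untouched. *)
Lemma psum_lift m l (a : 'S_m) (b : 'S_l) :
  psum (lift_perm ord0 ord0 a) b = lift_perm ord0 ord0 (psum a b) :> 'S_(m + l).+1.
Proof.
apply/permP => x; case: (unliftP ord0 x) => [y|] ->; last first.
  rewrite lift_perm_id (_ : ord0 = lshift l (ord0 : 'I_m.+1)); last exact/val_inj.
  by apply: (etrans (@psum_lshift m.+1 l _ _ _)); rewrite lift_perm_id.
rewrite lift_perm_lift; case: (split_ordP y) => z ->.
  rewrite (_ : lift ord0 _ = lshift l (lift ord0 z)); last exact/val_inj.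
  apply: (etrans (@psum_lshift m.+1 l _ _ _)); rewrite psum_lshift lift_perm_lift.
  exact/val_inj.
rewrite (_ : lift ord0 _ = rshift m.+1 z); last exact/val_inj.
by apply: (etrans (@psum_rshift m.+1 l _ _ _)); rewrite psum_rshift; exact/val_inj.
Qed.

Lemma psum_tperm m l (x y : 'I_m) :
  psum (tperm x y) 1 = tperm (lshift l x) (lshift l y).
Proof.
apply/permP => z; case: (split_ordP z) => w ->.
  by rewrite psum_lshift -(inj_tperm _ _ _ (@lshift_inj _ _)).
by rewrite psum_rshift perm1 tpermD // eq_lrshift.
Qed.

Lemma lift_perm_surj n (h : 'S_n.+1) : h ord0 = ord0 ->
  exists a : 'S_n, h = lift_perm ord0 ord0 a.
Proof.
(* The default [x] never occurs: [h] is injective and fixes [ord0], so it sends no lifted point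
   there. *)
move=> h0; pose f x := odflt x (unlift ord0 (h (lift ord0 x))).
have fE x : lift ord0 (f x) = h (lift ord0 x).
  rewrite /f; case: unliftP => [y -> //|] /=.
  by rewrite -[X in _ = X]h0 => /perm_inj/eqP; rewrite eq_sym (negPf (neq_lift _ _)).
have fI : injective f.
  by move=> x y /(congr1 (lift ord0)); rewrite !fE => /perm_inj/lift_inj.
exists (perm fI); apply/permP => x; case: (unliftP ord0 x) => [y|] ->.
  by rewrite lift_perm_lift permE fE.
by rewrite lift_perm_id.
Qed.

(** * Singleton blocks common to a whole chain *)

(** The two singletons are exchanged, and every other block avoids both points. *)
Lemma act_part_tperm n (P : setpart n) x y :
  is_setpart P -> [set x] \in P -> [set y] \in P -> act_part (tperm x y) P = P.
Proof.
move=> /setpartP[_ tP _] xP yP.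
apply/eqP; rewrite eqEcard card_act_part leqnn andbT.
apply/subsetP => _ /imsetP[B BP ->].
case: (boolP (x \in B)) => xB.
  by rewrite -(tP [set x] B x) ?inE // imset_set1 tpermL.
case: (boolP (y \in B)) => yB.
  by rewrite -(tP [set y] B y) ?inE // imset_set1 tpermR.
rewrite (_ : _ @: B = B) // -[RHS]imset_id; apply: eq_in_imset => z zB.
by rewrite tpermD //; [apply: contraNneq xB => -> | apply: contraNneq yB => ->].
Qed.

Lemma act_chain_tperm n S (D : {set setpart n}) x y : D \in chains n S ->
  (forall P, P \in D -> [set x] \in P) -> (forall P, P \in D -> [set y] \in P) ->
  act_chain (tperm x y) D = D.
Proof.
move=> /chainsP[pD _] xD yD; rewrite -[RHS]imset_id; apply: eq_in_imset => P PD.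
by rewrite act_part_tperm ?xD ?yD //; case: (pD P).
Qed.

(** Sum over the blocks of [2 <= #|B| + (#|B| == 1)], which holds because blocks are nonempty. *)
Lemma card_singletons n (P : setpart n) : is_setpart P ->
  (2 * #|P| <= n + #|[set x | [set x] \in P]|)%N.
Proof.
move=> Pp; have /setpartP[_ _ P0] := Pp.
have sumP : n = (\sum_(B in P) #|B|)%N.
  by rewrite -(card_partition Pp) cardsT card_ord.
rewrite [X in (_ <= X + _)%N]sumP.
have -> : #|[set x | [set x] \in P]| = (\sum_(B in P) (#|B| == 1))%N.
  rewrite -(card_imset _ (@set1_inj _)) -sum1_card big_mkcond.
  rewrite [RHS]big_mkcond; apply: eq_bigr => B _.
  case: imsetP => [[x]|nx]; first by rewrite inE => xP ->; rewrite xP cards1.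
  case: ifP => // BP; case: eqP => // /eqP/cards1P[x Bx]; case: nx.
  by exists x; rewrite // inE -Bx.
rewrite -big_split /= mulnC -sum_nat_const; apply: leq_sum => B BP.
have : (0 < #|B|)%N by rewrite card_gt0; apply: contraNneq P0 => <-.
by case: #|B| => [|[|]].
Qed.

Lemma singleton_refines n (P Q : setpart n) x : is_setpart P -> is_setpart Q ->
  refines P Q -> [set x] \in Q -> [set x] \in P.
Proof.
move=> /setpartP[cP _ _] /setpartP[_ tQ _] /refinesP rPQ xQ.
have [B BP xB] := cP x; have [C CQ sBC] := rPQ B BP.
suff <- : B = [set x] by [].
have E := tQ C _ _ CQ xQ (subsetP sBC _ xB) (set11 _).
by apply/eqP; rewrite eqEsubset sub1set xB -E sBC.
Qed.

(** A partition of rank at most [max S] has at least [m + l - 2 max S > l] singletons, too many to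
    fit in the last [l] points. Singletons of the coarsest member persist in all finer ones. *)
Lemma chain_singleton m l S (D : {set setpart (m + l)}) : D \in chains (m + l) S ->
  (2 * \max_(s <- S) s < m)%N ->
  exists q : 'I_m, forall P, P \in D -> [set lshift l q] \in P.
Proof.
move=> /chainsP[pD tD] lm; have m0 : (0 < m)%N by apply: leq_ltn_trans lm.
have [->|[P0 P0D]] := set_0Vmem D.
  by exists (Ordinal m0) => P; rewrite inE.
pose sing (P : setpart (m + l)) := [set x | [set x] \in P].
(* A member with the fewest singletons plays the role of the coarsest one. *)
case: (arg_minnP (fun P => #|sing P|) P0D) => P PD minP.
have [Pp PS] := pD P PD.
have rP : (prank P <= \max_(s <- S) s)%N by exact: leq_bigmax_seq.
have sP : (2 * #|P| <= m + l + #|sing P|)%N := card_singletons Pp.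
have [q qP]: exists q : 'I_m, [set lshift l q] \in P.
  apply/existsP; apply: contraTT lm; rewrite negb_exists => /forallP nq.
  have : (#|sing P| <= l)%N.
    rewrite -[X in (_ <= X)%N](card_ord l) -cardsT -(card_imset _ (@rshift_inj m l)).
    apply/subset_leq_card/subsetP => x; rewrite inE.
    by case: (split_ordP x) => y -> ; [rewrite (negPf (nq y)) | rewrite imset_f].
  by rewrite -leqNgt; move: rP sP; rewrite /prank; lia.
exists q => Q QD; have [Qp _] := pD Q QD.
(* If instead [P] refines [Q], minimality forces [Q] to have the same singletons as [P]. *)
have [rQP|rPQ] := orP (tD Q P QD PD); first exact: singleton_refines rQP qP.
have sQP : sing Q \subset sing P.
  by apply/subsetP => x; rewrite !inE; exact: singleton_refines rPQ.
have /eqP E : sing Q == sing P by rewrite eqEcard sQP minP.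
have : lshift l q \in sing P by rewrite inE.
by rewrite -E inE.
Qed.

(** * Adding a singleton, on orbits of chains *)

(** This is [ext_chain] with its target retyped by conversion to [m.+1 + l], the form in which
    [psum] splits off ['S_m.+1]. *)
Definition ext m l (C : {set setpart (m + l)}) : {set setpart (m.+1 + l)} :=
  ext_chain C.

Lemma ext_inj m l : injective (@ext m l).
Proof. exact: ext_chain_inj. Qed.

Lemma card_ext m l (C : {set setpart (m + l)}) : #|ext C| = #|C|.
Proof. exact: card_ext_chain. Qed.

Lemma chains_ext m l S (C : {set setpart (m + l)}) :
  (ext C \in chains (m.+1 + l) S) = (C \in chains (m + l) S).
Proof. exact: ext_chains. Qed.

Lemma ext_act m l (a : 'S_m) (b : 'S_l) (C : {set setpart (m + l)}) :
  ext (act_chain (psum a b) C) =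
  act_chain (psum (lift_perm ord0 ord0 a) b) (ext C).
Proof. by rewrite psum_lift; exact: ext_act_chain. Qed.

Lemma ext_mem0 m l (C : {set setpart (m + l)}) P :
  P \in ext C -> [set lshift l (ord0 : 'I_m.+1)] \in P.
Proof.
move=> /imsetP[Q _ ->]; rewrite (_ : @lshift m.+1 l ord0 = @ord0 (m + l)).
  exact: setU11.
exact/val_inj.
Qed.

(** Surjectivity on orbits: a common singleton among the first [m.+1] points is moved to [ord0] by a
    transposition and then deleted. *)
Lemma ext_surj m l S (D : {set setpart (m.+1 + l)}) :
  D \in chains (m.+1 + l) S -> (2 * \max_(s <- S) s <= m)%N ->
  exists2 C, C \in chains (m + l) S & exists h, ext C = act_chain (psum h 1) D.
Proof.
move=> Dc lm; have [q qD] := chain_singleton Dc lm.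
pose h := tperm q (ord0 : 'I_m.+1); pose E := act_chain (psum h 1) D.
have Ec : E \in chains (m + l).+1 S by rewrite act_chains.
have E0 P : P \in E -> [set ord0] \in P.
  case/imsetP=> Q QD ->; apply/imsetP; exists [set lshift l q]; first exact: qD.
  by rewrite imset_set1 psum_lshift tpermL; congr [set _]; exact/val_inj.
have EE := del_chainK Ec E0.
exists [set del_part P | P in E]; last by exists h; exact: EE.
by rewrite -chains_ext /ext EE.
Qed.

(* The points [0] and [h 0] are singletons throughout [ext C], so composing [h]
   with their transposition makes it fix [0] without changing its effect. *)
Lemma ext_orbit_inj m l S (C C' : {set setpart (m + l)}) (h : 'S_m.+1) :
  C \in chains (m + l) S -> ext C = act_chain (psum h 1) (ext C') ->
  exists a, C = act_chain (psum a 1) C'.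
Proof.
rewrite -chains_ext => Cc E; pose q := h ord0.
have qC P : P \in ext C -> [set lshift l q] \in P.
  rewrite E => /imsetP[Q /ext_mem0 Q0 ->]; apply/imsetP.
  by exists [set lshift l ord0]; rewrite ?imset_set1 ?psum_lshift.
have := act_chain_tperm Cc qC (@ext_mem0 _ _ _).
rewrite -psum_tperm {1}E -act_chainM -psumM mulg1.
have [|a ->] := @lift_perm_surj _ (h * tperm q ord0)%g.
  by rewrite permM tpermL.
by rewrite -ext_act => /ext_inj <-; exists a.
Qed.

(* A representative in [m + l] points of the 'S_m.+1-orbit of [D]; the default
   [set0] is never reached when [D] is a chain and [2 max S <= m]. *)
Definition rep S m l (D : {set setpart (m.+1 + l)}) : {set setpart (m + l)} :=
  odflt set0 [pick C in chains (m + l) S |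
    [exists h : 'S_m.+1, ext C == act_chain (psum h 1) D]].
Arguments rep S {m l} D.

Lemma repP S m l (D : {set setpart (m.+1 + l)}) :
  D \in chains (m.+1 + l) S -> (2 * \max_(s <- S) s <= m)%N ->
  rep S D \in chains (m + l) S /\
  exists h, ext (rep S D) = act_chain (psum h 1) D.
Proof.
move=> Dc lm; rewrite /rep; case: pickP => /= [C /andP[-> /existsP[h /eqP]]|].
  by split=> //; exists h.
have [C Cc [h hE]] := ext_surj Dc lm.
by move/(_ C); rewrite Cc => /existsP[]; exists h; rewrite hE.
Qed.

(** The extensions of the representative and of [act_chain (psum 1 b) C] lie in one ['S_m.+1]-orbit,
    so injectivity on orbits applies. *)
Lemma rep_act_ext S m l (C : {set setpart (m + l)}) (a : 'S_m.+1) (b : 'S_l) :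
  C \in chains (m + l) S -> (2 * \max_(s <- S) s <= m)%N ->
  exists a0, rep S (act_chain (psum a b) (ext C)) = act_chain (psum a0 b) C.
Proof.
move=> Cc lm; have [|rc [h hE]] := @repP S _ _ (act_chain (psum a b) (ext C)) _ lm.
  by rewrite act_chains chains_ext.
have [a0 a0E] : exists a0, rep S (act_chain (psum a b) (ext C)) =
    act_chain (psum a0 1) (act_chain (psum 1 b) C).
  apply: (ext_orbit_inj (h := (a * h)%g) rc).
  by rewrite hE ext_act -!act_chainM -!psumM lift_perm1 mul1g mulg1.
by exists a0; rewrite a0E -act_chainM -psumM mul1g mulg1.
Qed.

(** * Averaging over the first factor *)

Definition avg m (f : 'S_m -> algC) : algC := (m`!%:R)^-1 * \sum_(a : 'S_m) f a.

Lemma eq_avg m (f g : 'S_m -> algC) : f =1 g -> avg f = avg g.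
Proof. by move=> fg; congr (_ * _); apply: eq_bigr. Qed.

Lemma avg_const m (c : algC) : avg (fun _ : 'S_m => c) = c.
Proof.
rewrite /avg sumr_const (eq_card (B := {: 'S_m})) // card_Sn -[c *+ _]mulr_natl mulKf //.
by rewrite pnatr_eq0 -lt0n fact_gt0.
Qed.

Lemma avg_mulr m (f : 'S_m -> algC) c : avg f * c = avg (fun a => f a * c).
Proof. by rewrite /avg -mulrA mulr_suml. Qed.

Lemma avg_sum m I (r : seq I) (P : pred I) (F : I -> 'S_m -> algC) :
  \sum_(i <- r | P i) avg (F i) = avg (fun a => \sum_(i <- r | P i) F i a).
Proof. by rewrite /avg exchange_big mulr_sumr. Qed.

Lemma avg_mulg m (f : 'S_m -> algC) h : avg (fun a => f (h * a)%g) = avg f.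
Proof. by rewrite /avg; congr (_ * _); rewrite [RHS](reindex_inj (mulgI h)). Qed.

(* Matrix of the operator "act by [b] and project to 'S_m-invariants". *)
Definition avg_act m l (b : 'S_l) (C D : {set setpart (m + l)}) : algC :=
  avg (fun a : 'S_m => (act_chain (psum a b) C == D)%:R).

Lemma avg_act_psum m l (b b' : 'S_l) (a : 'S_m) (C D : {set setpart (m + l)}) :
  avg_act b (act_chain (psum a b') C) D = avg_act (b' * b)%g C D.
Proof.
by rewrite /avg_act -[RHS](avg_mulg _ a); apply: eq_avg => c; rewrite -act_chainM -psumM.
Qed.

(** Turns a product with [avg_act] into an average; the hypothesis keeps the support of the row of
    [C] inside [A]. *)
Lemma avg_act_sum m l (b : 'S_l) (A : {set {set setpart (m + l)}})
    (C : {set setpart (m + l)}) (f : {set setpart (m + l)} -> algC) :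
  (forall g, act_chain g C \in A) ->
  \sum_(D in A) avg_act b C D * f D = avg (fun a => f (act_chain (psum a b) C)).
Proof.
move=> CA; under eq_bigr => D _ do rewrite avg_mulr.
rewrite avg_sum; apply: eq_avg => a.
rewrite (bigD1 (act_chain (psum a b) C)) //= eqxx mul1r big1 ?addr0 // => D.
by case/andP=> _; rewrite eq_sym => /negPf ->; rewrite mul0r.
Qed.

(** * Matrices indexed by finite sets, and traces on kernels *)

Definition emx (T U : finType) (A : {set T}) (B : {set U}) (f : T -> U -> algC) :
    'M[algC]_(#|A|, #|B|) :=
  \matrix_(i, j) f (enum_val i) (enum_val j).

Lemma eq_emx (T U : finType) (A : {set T}) (B : {set U}) f g :
  (forall x y, x \in A -> y \in B -> f x y = g x y) -> emx A B f = emx A B g.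
Proof. by move=> fg; apply/matrixP => i j; rewrite !mxE fg ?enum_valP. Qed.

Lemma emx_mul (T U V : finType) (A : {set T}) (B : {set U}) (C : {set V}) f g :
  emx A B f *m emx B C g = emx A C (fun x z => \sum_(y in B) f x y * g y z).
Proof.
apply/matrixP => i j; rewrite !mxE [RHS]big_enum_val /=.
by apply: eq_bigr => k _; rewrite !mxE.
Qed.

Lemma emx_tr (T : finType) (A : {set T}) f : \tr (emx A A f) = \sum_(x in A) f x x.
Proof.
by rewrite /mxtrace [RHS]big_enum_val; apply: eq_bigr => i _; rewrite mxE.
Qed.

(** When [A] preserves the left kernel of [d], this is the trace of the induced endomorphism;
    [beta_char] is the case of [chain_permmx]. *)
Definition ker_tr p q (d : 'M[algC]_(p, q)) (A : 'M_p) : algC :=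
  let B := row_base (kermx d) in \tr (B *m A *m pinvmx B).

(** The basis of the kernel does not depend on [A], so [ker_tr] is linear in [A]. *)
Lemma avg_ker_tr p q (d : 'M[algC]_(p, q)) m (A : 'S_m -> 'M_p) :
  avg (fun a => ker_tr d (A a)) = ker_tr d ((m`!%:R)^-1 *: \sum_a A a).
Proof.
rewrite /ker_tr /avg -scalemxAr -scalemxAl linearZ /= mulmx_sumr mulmx_suml.
by rewrite raddf_sum.
Qed.

(* [tr (XY) = tr (YX)] for the maps [X], [Y] induced between the two kernels. *)
Lemma ker_trC p q p' q' (d : 'M[algC]_(p, q)) (d' : 'M[algC]_(p', q'))
    (F : 'M_(p, p')) (G : 'M_(p', p)) (F' : 'M_(q, q')) (G' : 'M_(q', q)) :
  F *m d' = d *m F' -> G *m d = d' *m G' ->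
  ker_tr d (F *m G) = ker_tr d' (G *m F).
Proof.
move=> FE GE; rewrite /ker_tr.
set B := row_base (kermx d); set B' := row_base (kermx d').
have B0 : B *m d = 0 by apply/sub_kermxP; rewrite eq_row_base.
have B'0 : B' *m d' = 0 by apply/sub_kermxP; rewrite eq_row_base.
have BF : (B *m F <= B')%MS.
  by rewrite eq_row_base; apply/sub_kermxP; rewrite -mulmxA FE mulmxA B0 mul0mx.
have BG : (B' *m G <= B)%MS.
  by rewrite eq_row_base; apply/sub_kermxP; rewrite -mulmxA GE mulmxA B'0 mul0mx.
move: (pinvmx B) (pinvmx B') (mulmxKpV BF) (mulmxKpV BG) => V V' BFE BGE.
clearbody B B'.
(* Inserting [V' *m B'] after [B *m F] changes nothing, as the rows of [B *m F] lie in the row space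
   of [B']. *)
have -> : B *m (F *m G) *m V = (B *m F *m V') *m (B' *m G *m V).
  by rewrite !mulmxA BFE.
have -> : B' *m (G *m F) *m V' = (B' *m G *m V) *m (B *m F *m V').
  by rewrite !mulmxA BGE.
exact: mxtrace_mulC.
Qed.

(** * Mutually inverse maps between coinvariants *)

(** Abstracts what maximal chains and top chains share, so that the same pair of matrices serves
    both characters. *)
Definition stable_family S m l (A : {set {set setpart (m + l)}})
    (A' : {set {set setpart (m.+1 + l)}}) : Prop :=
  [/\ A \subset chains (m + l) S, A' \subset chains (m.+1 + l) S,
      forall g C, (act_chain g C \in A) = (C \in A),
      forall g D, (act_chain g D \in A') = (D \in A')
    & forall C, C \in chains (m + l) S -> (ext C \in A') = (C \in A)].

Lemma rep_family S m l A A' (D : {set setpart (m.+1 + l)}) :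
  @stable_family S m l A A' -> (2 * \max_(s <- S) s <= m)%N ->
  D \in A' -> rep S D \in A.
Proof.
case=> _ /subsetP sA' _ aA' eA lm DA'.
have [rc [h hE]] := repP (sA' D DA') lm.
by rewrite -eA // hE aA'.
Qed.

(** The permutation left undetermined by [rep_act_ext] lies in ['S_m] and is absorbed by the
    average. *)
Lemma avg_act_rep S m l (a : 'S_m.+1) (b : 'S_l) (C C' : {set setpart (m + l)}) :
  C \in chains (m + l) S -> (2 * \max_(s <- S) s <= m)%N ->
  avg_act 1 (rep S (act_chain (psum a b) (ext C))) C' = avg_act b C C'.
Proof. by move=> Cc lm; have [a0 ->] := rep_act_ext a b Cc lm; rewrite avg_act_psum mulg1. Qed.

(** Although [rep] involves a choice, its averaged row depends only on the ['S_m.+1]-orbit of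
    [D]. *)
Lemma avg_act_rep_act S m l (h : 'S_m.+1) (D : {set setpart (m.+1 + l)}) C :
  D \in chains (m.+1 + l) S -> (2 * \max_(s <- S) s <= m)%N ->
  avg_act 1 (rep S (act_chain (psum h 1) D)) C = avg_act 1 (rep S D) C.
Proof.
move=> Dc lm; have [rc [h' hE]] := repP Dc lm.
have DE : D = act_chain (psum h'^-1 1) (ext (rep S D)).
  by rewrite hE -act_chainM -psumM mulgV mulg1 psum1 act_chain1.
by rewrite [in LHS]DE -act_chainM -psumM mulg1 (avg_act_rep _ _ _ rc lm).
Qed.

Lemma avg_act_ext_act_rep S m l (a : 'S_m) (b : 'S_l) (D D' : {set setpart (m.+1 + l)}) :
  D \in chains (m.+1 + l) S -> (2 * \max_(s <- S) s <= m)%N ->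
  avg_act b (ext (act_chain (psum a 1) (rep S D))) D' = avg_act b D D'.
Proof.
move=> Dc lm; have [_ [h hE]] := repP Dc lm.
by rewrite ext_act avg_act_psum mul1g hE avg_act_psum mul1g.
Qed.

(** For [b = 1] the product is the averaging projector, which is the identity on coinvariants. *)
Lemma avg_act_ext_rep S m l (b : 'S_l) A A' :
  @stable_family S m l A A' -> (2 * \max_(s <- S) s <= m)%N ->
  emx A A' (fun C D => avg_act b (ext C) D) *m emx A' A (fun D C => avg_act 1 (rep S D) C) =
  emx A A (avg_act b).
Proof.
move=> fA lm; have [/subsetP sA _ aA aA' eA] := fA.
rewrite emx_mul; apply: eq_emx => C C' CA _.
rewrite (avg_act_sum _ (fun D => avg_act 1 (rep S D) C')); last first.
  by move=> g; rewrite aA' eA // sA.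
(* Each term of the average over ['S_m.+1] already equals the right side, which is therefore written
   as a constant average. *)
rewrite -[RHS](avg_const m.+1); apply: eq_avg => a.
by rewrite avg_act_rep // sA.
Qed.

Lemma avg_act_rep_ext S m l (b : 'S_l) A A' :
  @stable_family S m l A A' -> (2 * \max_(s <- S) s <= m)%N ->
  emx A' A (fun D C => avg_act 1 (rep S D) C) *m emx A A' (fun C D => avg_act b (ext C) D) =
  emx A' A' (avg_act b).
Proof.
move=> fA lm; have [_ /subsetP sA' aA aA' eA] := fA.
rewrite emx_mul; apply: eq_emx => D D' DA' _.
rewrite (avg_act_sum _ (fun C => avg_act b (ext C) D')); last first.
  by move=> g; rewrite aA; exact: rep_family DA'.
rewrite -[RHS](avg_const m); apply: eq_avg => a.
by rewrite avg_act_ext_act_rep // sA'.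
Qed.

(** * Stability of top chains and maximal chains *)

Lemma in_topchains n S (C : {set setpart n}) :
  (C \in topchains n S) = (C \in chains n S) && (#|C| == topsize n S).
Proof. exact: in_set. Qed.

Lemma in_subchains n S (C : {set setpart n}) :
  (C \in subchains n S) = (C \in chains n S) && (#|C| == (topsize n S).-1).
Proof. exact: in_set. Qed.

Lemma act_topchains n S (g : 'S_n) C :
  (act_chain g C \in topchains n S) = (C \in topchains n S).
Proof. by rewrite !in_topchains act_chains card_act_chain. Qed.

Lemma maxchainsP n S (C : {set setpart n}) :
  reflect (C \in chains n S /\ forall D, D \in chains n S -> C \subset D -> D = C)
          (C \in maxchains n S).
Proof.
rewrite [C \in maxchains _ _]in_set; apply: (iffP andP) => [[Cc /forall_inP H]|[Cc H]]; split=> //.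
  by move=> D Dc sCD; exact/eqP/(implyP (H D Dc)).
by apply/forall_inP => D Dc; apply/implyP => sCD; apply/eqP/H.
Qed.

Lemma act_maxchains n S (g : 'S_n) C :
  (act_chain g C \in maxchains n S) = (C \in maxchains n S).
Proof.
suff imp h E : E \in maxchains n S -> act_chain h E \in maxchains n S.
  by apply/idP/idP => [/(imp g^-1%g)|]; [rewrite act_chainK | exact: imp].
case/maxchainsP=> Ec mE; apply/maxchainsP; rewrite act_chains; split=> // D Dc sD.
rewrite -[D](act_chainK h^-1%g) invgK -[in RHS](mE (act_chain h^-1%g D)) //.
  by rewrite act_chains.
by rewrite -[E](act_chainK h); exact: imsetS.
Qed.

(** Up to a permutation, which keeps sizes, every chain on the larger set is an extension. *)
Lemma topsize_ext S m l : (2 * \max_(s <- S) s <= m)%N ->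
  topsize (m.+1 + l) S = topsize (m + l) S.
Proof.
move=> lm; apply/eqP; rewrite eqn_leq; apply/andP; split; apply/bigmax_leqP => C Cc.
  have [rc [h hE]] := repP Cc lm.
  by rewrite -(card_act_chain (psum h 1)) -hE card_ext leq_bigmax_cond.
by rewrite -card_ext leq_bigmax_cond // chains_ext.
Qed.

Lemma topchains_family S m l : (2 * \max_(s <- S) s <= m)%N ->
  stable_family S (topchains (m + l) S) (topchains (m.+1 + l) S).
Proof.
move=> lm; split; try exact: act_topchains.
- by apply/subsetP => C; rewrite in_topchains => /andP[].
- by apply/subsetP => C; rewrite in_topchains => /andP[].
- by move=> C Cc; rewrite !in_topchains chains_ext card_ext topsize_ext.
Qed.

Lemma maxchains_family S m l : (2 * \max_(s <- S) s <= m)%N ->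
  stable_family S (maxchains (m + l) S) (maxchains (m.+1 + l) S).
Proof.
move=> lm; split; try exact: act_maxchains.
- by apply/subsetP => C /maxchainsP[].
- by apply/subsetP => C /maxchainsP[].
move=> C Cc; apply/maxchainsP/maxchainsP => -[_ mC]; split=> //.
- move=> D Dc sCD; apply: ext_inj; apply: mC; first by rewrite chains_ext.
  exact: imsetS.
- by rewrite chains_ext.
(* A chain [D] above [ext C] need not be an extension itself, so it is first moved to
   [ext (rep S D)]. *)
move=> D Dc sCD; have [rc [h hE]] := repP Dc lm.
have sC : act_chain (psum h 1) (ext C) \subset ext (rep S D).
  by rewrite hE; exact: imsetS.
pose C2 := [set P in rep S D | ext_part P \in act_chain (psum h 1) (ext C)].
have C2E : ext C2 = act_chain (psum h 1) (ext C).
  apply/setP => P; apply/imsetP/idP => [[Q]|PC]; first by rewrite inE => /andP[_ + ->].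
  by have /imsetP[Q QD PE] := subsetP sC P PC; exists Q; rewrite // inE QD -PE.
have sC2 : C2 \subset rep S D by apply/subsetP => P; rewrite inE => /andP[].
(* [C2] lies in the ['S_m]-orbit of [C], hence is maximal and equals [rep S D]; comparing sizes then
   gives [D = ext C]. *)
have [a aE] := ext_orbit_inj (chains_sub sC2 rc) C2E.
have /maxchainsP[_ mC2] : C2 \in maxchains (m + l) S.
  by rewrite aE act_maxchains; apply/maxchainsP.
apply/esym/eqP; rewrite eqEcard sCD -(card_act_chain (psum h 1) D) -hE.
by rewrite (mC2 _ rc sC2) C2E card_act_chain leqnn.
Qed.

(** * Compatibility with the boundary map *)

(** The linear extension of [f], evaluated at the simplicial boundary of [C]. *)
Definition bd_sum n (f : {set setpart n} -> algC) (C : {set setpart n}) : algC :=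
  \sum_(P in C) (-1) ^+ #|[set Q in C | refines_strict Q P]| * f (C :\ P).

(** The signs count members strictly below the removed one, and [phi] preserves and reflects strict
    refinement on [C]. *)
Lemma bd_sum_imset n n' (phi : setpart n -> setpart n') f (C : {set setpart n}) :
  injective phi ->
  {in C &, forall P Q, refines_strict (phi P) (phi Q) = refines_strict P Q} ->
  bd_sum f (phi @: C) = bd_sum (fun D : {set setpart n} => f (phi @: D)) C.
Proof.
move=> phiI phiR; rewrite /bd_sum big_imset; last by move=> P Q _ _ /phiI.
apply: eq_bigr => P PC; congr (_ ^+ _ * f _).
  rewrite -(card_imset _ phiI); apply: eq_card => Q; rewrite inE.
  apply/andP/imsetP => [[/imsetP[R RC ->]]|[R]].
    by rewrite phiR // => RP; exists R; rewrite // inE RC.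
  by rewrite inE => /andP[RC RP] ->; rewrite imset_f // phiR.
apply/setP => R; rewrite !inE; apply/andP/imsetP => [[nRP /imsetP[Q QC RE]]|[Q]].
  by exists Q; rewrite // !inE QC andbT; apply: contraNneq nRP => <-; rewrite RE.
by rewrite !inE => /andP[QP QC] ->; rewrite (inj_eq phiI) QP imset_f.
Qed.

Lemma bd_sum_act n (g : 'S_n) f (C : {set setpart n}) :
  bd_sum f (act_chain g C) = bd_sum (fun D => f (act_chain g D)) C.
Proof.
apply: bd_sum_imset => [|P Q _ _]; first exact: act_part_inj.
exact: refines_strict_act.
Qed.

Lemma bd_sum_ext S m l f (C : {set setpart (m + l)}) : C \in chains (m + l) S ->
  bd_sum f (ext C) = bd_sum (fun D => f (ext D)) C.
Proof.
move=> /chainsP[pC _]; apply: bd_sum_imset => [|P Q PC QC]; first exact: ext_part_inj.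
rewrite /refines_strict (inj_eq (@ext_part_inj _)) refines_ext //.
by case: (pC P PC).
Qed.

Lemma eq_bd_sum n (f g : {set setpart n} -> algC) (C : {set setpart n}) :
  (forall P, P \in C -> f (C :\ P) = g (C :\ P)) -> bd_sum f C = bd_sum g C.
Proof. by move=> fg; apply: eq_bigr => P PC; rewrite fg. Qed.

Lemma bd_sum_avg n m (f : 'S_m -> {set setpart n} -> algC) C :
  bd_sum (fun D => avg (f ^~ D)) C = avg (fun a => bd_sum (f a) C).
Proof.
rewrite /bd_sum -avg_sum; apply: eq_bigr => P _.
by rewrite mulrC avg_mulr; apply: eq_avg => a; rewrite mulrC.
Qed.

Lemma boundaryE n S : boundary n S =
  emx (topchains n S) (subchains n S) (fun C D => bd_sum (fun E => (E == D)%:R) C).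
Proof.
apply/matrixP => i j; rewrite !mxE /bd_sum big_mkcondr; apply: eq_bigr => P _.
by case: eqP; rewrite ?mulr1 ?mulr0.
Qed.

Lemma topchains_setD1 n S (C : {set setpart n}) P :
  C \in topchains n S -> P \in C -> C :\ P \in subchains n S.
Proof.
rewrite in_topchains in_subchains => /andP[Cc /eqP <-] PC.
by rewrite (chains_sub (subsetDl _ _) Cc) (cardsD1 P C) PC /=.
Qed.

(** All faces of a top chain lie in [subchains], so the sum loses no term. *)
Lemma boundary_sum n S (f : {set setpart n} -> algC) C : C \in topchains n S ->
  \sum_(D in subchains n S) bd_sum (fun E => (E == D)%:R) C * f D = bd_sum f C.
Proof.
move=> Ct; under eq_bigr => D _ do rewrite mulr_suml.
rewrite exchange_big; apply: eq_bigr => P PC /=.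
rewrite (bigD1 (C :\ P)) /= ?topchains_setD1 // eqxx mulr1 big1 ?addr0 // => D.
by case/andP=> _; rewrite eq_sym => /negPf ->; rewrite mulr0 mul0r.
Qed.

Lemma avg_act_ext_boundary S m l (b : 'S_l) : (2 * \max_(s <- S) s <= m)%N ->
  emx (topchains (m + l) S) (topchains (m.+1 + l) S) (fun C D => avg_act b (ext C) D)
    *m boundary (m.+1 + l) S =
  boundary (m + l) S *m
  emx (subchains (m + l) S) (subchains (m.+1 + l) S) (fun C D => avg_act b (ext C) D).
Proof.
move=> lm; have [/subsetP sT _ _ aT' eT] := @topchains_family S m l lm.
rewrite !boundaryE !emx_mul; apply: eq_emx => C D0 CT _.
rewrite (boundary_sum (fun C0 => avg_act b (ext C0) D0)) //.
rewrite (avg_act_sum _ (bd_sum (fun E => (E == D0)%:R))); last first.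
  by move=> g; rewrite aT' eT // sT.
rewrite bd_sum_avg; apply: eq_avg => a.
by rewrite bd_sum_act (bd_sum_ext _ (sT _ CT)).
Qed.

(** [rep] is chosen separately for [D] and for each of its faces; the choices agree only up to
    ['S_m], which averaging absorbs. *)
Lemma avg_act_rep_boundary S m l : (2 * \max_(s <- S) s <= m)%N ->
  emx (topchains (m.+1 + l) S) (topchains (m + l) S) (fun D C => avg_act 1 (rep S D) C)
    *m boundary (m + l) S =
  boundary (m.+1 + l) S *m
  emx (subchains (m.+1 + l) S) (subchains (m + l) S) (fun D C => avg_act 1 (rep S D) C).
Proof.
move=> lm; have fT := @topchains_family S m l lm.
have [/subsetP sT /subsetP sT' aT _ _] := fT.
rewrite !boundaryE !emx_mul; apply: eq_emx => D C0 DT _.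
rewrite (boundary_sum (fun D0 => avg_act 1 (rep S D0) C0)) //.
have rT := rep_family fT lm DT.
rewrite (avg_act_sum _ (bd_sum (fun E => (E == C0)%:R))); last first.
  by move=> g; rewrite aT.
have [rc [h hE]] := repP (sT' _ DT) lm.
transitivity (bd_sum (fun C => avg_act 1 C C0) (rep S D)).
  by rewrite bd_sum_avg; apply: eq_avg => a; rewrite bd_sum_act.
(* Each face of [rep S D] has the same averaged row as the representative of its extension. *)
transitivity (bd_sum (fun D0 => avg_act 1 (rep S D0) C0) (ext (rep S D))).
  rewrite (bd_sum_ext _ rc); apply: eq_bd_sum => P PC.
  rewrite -[ext _]act_chain1 -psum1 avg_act_rep //.
  exact: chains_sub (subsetDl _ _) rc.
(* The faces of [ext (rep S D)] are the translates by [h] of the faces of [D]. *)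
rewrite hE bd_sum_act; apply: eq_bd_sum => P PD.
apply: avg_act_rep_act lm; exact: chains_sub (subsetDl _ _) (sT' _ DT).
Qed.

(** * Averaged characters and stability *)

(** The number of fixed maximal chains is the trace of the permutation matrix, and the trace is
    linear. *)
Lemma avg_alpha S m l (b : 'S_l) :
  avg (fun a : 'S_m => alpha_char S (psum a b)) =
  \tr (emx (maxchains (m + l) S) (maxchains (m + l) S) (avg_act b)).
Proof.
rewrite emx_tr avg_sum; apply: eq_avg => a.
rewrite /alpha_char -sum1_card natr_sum big_mkcond [RHS]big_mkcond.
by apply: eq_bigr => C _; rewrite in_set; case: (C \in _) => //=; case: eqP.
Qed.

Lemma avg_beta S m l (b : 'S_l) :
  avg (fun a : 'S_m => beta_char S (psum a b)) =
  ker_tr (boundary (m + l) S)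
    (emx (topchains (m + l) S) (topchains (m + l) S) (avg_act b)).
Proof.
rewrite [LHS]avg_ker_tr; congr ker_tr; apply/matrixP => i j.
rewrite !mxE summxE /avg_act /avg; congr (_ * _); apply: eq_bigr => a _.
by rewrite mxE eq_sym.
Qed.

Lemma avg_alphaS S m l (b : 'S_l) : (2 * \max_(s <- S) s <= m)%N ->
  avg (fun a : 'S_m.+1 => alpha_char S (psum a b)) =
  avg (fun a : 'S_m => alpha_char S (psum a b)).
Proof.
move=> lm; have fA := @maxchains_family S m l lm.
by rewrite !avg_alpha -(avg_act_ext_rep b fA lm) -(avg_act_rep_ext b fA lm) mxtrace_mulC.
Qed.

(** The argument for [alpha_char] carries over to homology because both matrices commute with the
    boundary, as [ker_trC] requires. *)
Lemma avg_betaS S m l (b : 'S_l) : (2 * \max_(s <- S) s <= m)%N ->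
  avg (fun a : 'S_m.+1 => beta_char S (psum a b)) =
  avg (fun a : 'S_m => beta_char S (psum a b)).
Proof.
move=> lm; have fA := @topchains_family S m l lm.
rewrite !avg_beta -(avg_act_ext_rep b fA lm) -(avg_act_rep_ext b fA lm).
by apply/esym/ker_trC; [exact: avg_act_ext_boundary | exact: avg_act_rep_boundary].
Qed.

(** Isolates the average over ['S_m], the only factor that depends on [m]. *)
Lemma young_dot_avg (chi : forall N : nat, 'S_N -> algC) m l
    (i : Iirr [set: 'S_l]%G) :
  young_dot chi m i = (l`!%:R)^-1 *
    \sum_(b : 'S_l) avg (fun a : 'S_m => chi _ (psum a b)) * ('chi_i b)^*.
Proof.
rewrite /young_dot natrM invfM [_^-1 * _^-1]mulrC -mulrA; congr (_ * _).
rewrite exchange_big mulr_sumr; apply: eq_bigr => b _.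
by rewrite -mulrA mulr_suml.
Qed.

Lemma young_dot_stable (chi : forall N : nat, 'S_N -> algC) M l :
  (forall m (b : 'S_l), (M <= m)%N -> avg (fun a : 'S_m.+1 => chi _ (psum a b)) =
     avg (fun a : 'S_m => chi _ (psum a b))) ->
  forall m1 m2 (i : Iirr [set: 'S_l]%G), (M <= m1)%N -> (M <= m2)%N ->
  young_dot chi m1 i = young_dot chi m2 i.
Proof.
move=> step m1 m2 i.
suff base m : (M <= m)%N -> young_dot chi m i = young_dot chi M i.
  by move=> /base -> /base ->.
move=> /subnK <-; elim: (m - M)%N => [//|d <-].
rewrite !young_dot_avg; congr (_ * _); apply: eq_bigr => b _.
by rewrite addSn step // leq_addl.
Qed.

Theorem theorem5p3 (S : seq nat) (k : nat) :
  S != [::] -> all (fun s => 0 < s)%N S ->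
  forall (l m1 m2 : nat), (l <= k)%N ->
  (2 * \max_(s <- S) s + k <= m1 + l)%N ->
  (2 * \max_(s <- S) s + k <= m2 + l)%N ->
  forall i : Iirr [set: 'S_l]%G,
    young_dot (alpha_char S) m1 i = young_dot (alpha_char S) m2 i /\
    young_dot (beta_char S) m1 i = young_dot (beta_char S) m2 i.
Proof.
move=> _ _ l m1 m2 lk h1 h2 i.
(* Here [n = m1 + l], and [l <= k] turns the bound on [n] into the bound on [m1] needed for
   stability. *)
have lm1 : (2 * \max_(s <- S) s <= m1)%N by lia.
have lm2 : (2 * \max_(s <- S) s <= m2)%N by lia.
split; apply: young_dot_stable lm1 lm2 => m b lm.
  exact: avg_alphaS.
exact: avg_betaS.
Qed.
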